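(* Let $\mathbb{X}$ be a metrizable topological space with its Borel $\sigma$-algebra, and let $\mathbb{Y}$ be a measurable space whose $\sigma$-algebra is countably generated and contains all singletons. Let $h\colon\mathbb{X}\to\mathbb{Y}$ be measurable and let $\mu,\nu$ be $\sigma$-finite Radon measures on $\mathbb{X}$ such that $h_\star\mu$ and $h_\star\nu$ are $\sigma$-finite. Suppose $\mu\ll\nu$. Then, for $h_\star\mu$-almost every $y\in\mathbb{Y}$, $\mu^h(\,\cdot\mid y)$ is absolutely continuous with respect to $\nu^h(\,\cdot\mid y)$ and $$\frac{d\mu^h(\,\cdot\mid y)}{d\nu^h(\,\cdot\mid y)}=\frac{\frac{d\mu}{d\nu}}{\nu^h\bigl(\frac{d\mu}{d\nu}\mid y\bigr)},$$ where $\nu^h\bigl(\frac{d\mu}{d\nu}\mid y\bigr)>0$ for $h_\star\mu$-almost every $y$.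
   Context: Disintegration: given a measurable map $h\colon\mathbb{X}\to\mathbb{Y}$ and a measure $\mu$ on $\mathbb{X}$, a disintegration of $\mu$ with respect to $h$ is a map $(A,y)\mapsto\mu^h(A\mid y)\in[0,\infty]$ such that $\mu^h(\,\cdot\mid y)$ is a measure on $\mathbb{X}$ for all $y\in\mathbb{Y}$, $y\mapsto\mu^h(A\mid y)$ is measurable for every measurable $A\subset\mathbb{X}$, (i) $\mu^h(\mathbb{X}\setminus h^{-1}(\{y\})\mid y)=0$, and (ii) $\mu(A)=\int_{\mathbb{Y}}\mu^h(A\mid y)\,h_\star\mu(dy)$ for every measurable $A$, where $h_\star\mu$ is the pushforward. Under the assumptions here it exists and is unique up to $h_\star\mu$-null sets of $y$. Notation: $\nu^h(\varphi\mid y):=\int_{\mathbb{X}}\varphi(x)\,\nu^h(dx\mid y)$ for non-negative measurable $\varphi$. *)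

(* Defs.v *)
From HB Require Import structures.
From mathcomp Require Import all_boot all_order all_algebra.
From mathcomp Require Import all_classical all_reals all_analysis.
From mathcomp Require Import measurable_realfun.

Set Implicit Arguments.
Unset Strict Implicit.
Unset Printing Implicit Defensive.
Import Order.TTheory GRing.Theory Num.Theory.
Import numFieldNormedType.Exports.

Local Open Scope classical_set_scope.
Local Open Scope ring_scope.
Local Open Scope ereal_scope.

Definition metrizable (R : realType) (X : topologicalType) : Prop :=
  exists dist : X -> X -> R,
    [/\ (forall x y, (0 <= dist x y)%R /\ (dist x y = 0%R <-> x = y)),
        (forall x y, dist x y = dist y x),
        (forall x y z, (dist x z <= dist x y + dist y z)%R) &
        forall (x : X) (A : set X),
          nbhs x A <->
          exists2 e : R, (0 < e)%R & [set y | (dist x y < e)%R] `<=` A].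

Notation borel X := (g_sigma_algebraType (@open X)).

(* Compact sets of a Hausdorff space are closed, hence Borel. On a metrizable
   space, finiteness on compact sets and inner regularity with respect to
   compact sets together imply local finiteness. *)
Definition radon (R : realType) (X : ptopologicalType)
    (mu : {measure set (borel X) -> \bar R}) : Prop :=
  (forall K : set X, compact K -> mu K < +oo) /\
  (forall A : set (borel X), measurable A ->
    mu A = ereal_sup [set mu K | K in [set K : set X | compact K /\ K `<=` A]]).

Definition countably_generated d (Y : measurableType d) : Prop :=
  exists2 G : set (set Y), countable G & @measurable d Y = <<s G >>.

Definition disintegration d d' (X : measurableType d) (Y : measurableType d')
    (R : realType) (mu : {measure set X -> \bar R}) (h : X -> Y)
    (muh : R.-ker Y ~> X) : Prop :=
  (forall y, muh y (~` (h @^-1` [set y])) = 0) /\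
  (forall A, measurable A -> mu A = \int[pushforward mu h]_y muh y A).

(* f is a version of the density of mu with respect to nu. The library's
   ['d mu '/d nu] is only available for finite mu. *)
Definition is_density d (T : measurableType d) (R : realType)
    (mu nu : {measure set T -> \bar R}) (f : T -> \bar R) : Prop :=
  [/\ measurable_fun [set: T] f,
      (forall x, 0 <= f x) &
      forall A, measurable A -> mu A = \int[nu]_(x in A) f x].

(* Main.v *)
(* Put rho = h_* nu, lam = h_* mu and N(y) = \int f d nu^h(.|y).  Computing
   mu(A `&` h^-1(B)) with either disintegration shows that lam has density N with
   respect to rho and that N(y) mu^h(A|y) = \int_A f d nu^h(.|y) for rho-almost
   every y, for each fixed A.  Since lam is sigma-finite, N is finite
   rho-almost everywhere, and N is positive lam-almost everywhere, so one may
   divide by N.  To get all A at once, one uses that mu is carried by a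
   sigma-compact set: along it countably many open balls form a base, and two
   finite measures carried by it that agree on finite unions of these balls
   are equal. *)

Require Import Defs.
From HB Require Import structures.
From mathcomp Require Import all_boot all_order all_algebra.
From mathcomp Require Import all_classical all_reals all_analysis.
From mathcomp Require Import measurable_realfun.

Set Implicit Arguments.
Unset Strict Implicit.
Unset Printing Implicit Defensive.
Import Order.TTheory GRing.Theory Num.Theory.
Import numFieldNormedType.Exports.

Local Open Scope classical_set_scope.
Local Open Scope ring_scope.
Local Open Scope ereal_scope.

(** * Mixtures of measures, densities, and almost-everywhere comparison *)

Section mixture.
Context d d' (X : measurableType d) (Y : measurableType d') (R : realType).
Variables (rho : {measure set Y -> \bar R}) (k : Y -> {measure set X -> \bar R}).
Variable m : {measure set X -> \bar R}.
Hypothesis mk : forall A, measurable A -> measurable_fun [set: Y] (k ^~ A).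
Hypothesis mE : forall A, measurable A -> m A = \int[rho]_y k y A.

Import HBNNSimple.

Lemma integral_mixture_nnsfun (g : {nnsfun X >-> R}) :
  \int[m]_x (g x)%:E = \int[rho]_y \int[k y]_x (g x)%:E.
Proof.
rewrite integralT_nnsfun sintegralE.
under [RHS]eq_integral do rewrite integralT_nnsfun sintegralE.
rewrite ge0_integral_fsum//; last 2 first.
- by move=> r; apply: measurable_funeM; exact: mk.
(* For [r] negative the level set of [g] is empty, so the summand vanishes instead of being
   negative. *)
- move=> r y _.
  by apply: (mulemu_ge0 (fun r => g @^-1` [set r])); exact: preimage_nnfun0.
apply: eq_fsbigr => r /[!inE] -[x _ <-].
rewrite ge0_integralZl//; [by rewrite mE|exact: mk|by rewrite lee_fin].
Qed.

(** Monotone convergence along simple approximations of [phi], used for [m], for every [k y] and for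
    the outer integral against [rho], reduces this to simple functions. *)
Lemma integral_mixture (phi : X -> \bar R) :
  measurable_fun [set: X] phi -> (forall x, 0 <= phi x) ->
  \int[m]_x phi x = \int[rho]_y \int[k y]_x phi x.
Proof.
move=> mphi phi0; pose g := nnsfun_approx measurableT mphi.
have gphi x : ((g n x)%:E @[n --> \oo]) --> phi x.
  exact: cvg_nnsfun_approx.
have mg n : measurable_fun [set: X] (fun x => (g n x)%:E).
  exact/measurable_EFinP.
have g0 n x : 0 <= (g n x)%:E by rewrite lee_fin.
have ndg x : {homo (fun n => (g n x)%:E) : a b / (a <= b)%N >-> a <= b}.
  by move=> a b ab; rewrite lee_fin; exact/lefP/nd_nnsfun_approx.
have limg (m' : {measure set X -> \bar R}) :
    \int[m']_x phi x = limn (fun n => \int[m']_x (g n x)%:E).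
  rewrite -monotone_convergence//.
  by apply: eq_integral => x _; apply/esym/cvg_lim.
rewrite limg; under [RHS]eq_integral do rewrite limg.
rewrite monotone_convergence//.
- by congr (limn _); apply/funext => n; exact: integral_mixture_nnsfun.
- by move=> n; exact: measurable_fun_integral_kernel.
- by move=> n y _; exact: integral_ge0.
- move=> y _ a b ab; apply: ge0_le_integral => //.
  by move=> x _; exact: ndg.
Qed.

End mixture.

(** A measure with density [N] is the mixture over [nu] of the Dirac masses at [x] scaled by [N x],
    so this is a case of [integral_mixture]. The scaling factor must be a nonnegative real, hence
    the real-valued [N]. *)
Lemma integral_density d (T : measurableType d) (R : realType)
    (mu nu : {measure set T -> \bar R}) (N : T -> R) (phi : T -> \bar R) :
  measurable_fun [set: T] N -> (forall x, (0 <= N x)%R) ->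
  (forall A, measurable A -> mu A = \int[nu]_(x in A) (N x)%:E) ->
  measurable_fun [set: T] phi -> (forall x, 0 <= phi x) ->
  \int[mu]_x phi x = \int[nu]_x ((N x)%:E * phi x).
Proof.
move=> mN N0 muE mphi phi0.
pose k x : {measure set T -> \bar R} := mscale (NngNum (N0 x)) \d_x.
have kE x A : measurable A -> k x A = (N x)%:E * \d_x A by [].
rewrite (@integral_mixture _ _ _ _ _ nu k)//.
- apply: eq_integral => x _.
  by rewrite /k ge0_integral_mscale//= integral_dirac// diracT mul1e.
- move=> A mA; rewrite [X in measurable_fun _ X](_ : _ = EFin \o (N \* \1_A))%R.
    by apply/measurable_EFinP; exact: measurable_funM.
  by apply/funext => x; rewrite kE// diracE -EFinM.
- move=> A mA; rewrite muE// integral_mkcond; apply: eq_integral => x _.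
  by rewrite kE// patchE diracE; case: ifPn => _; rewrite ?mule1 ?mule0.
Qed.

Section with_density.
Context d (T : measurableType d) (R : realType).
Variables (nu : {measure set T -> \bar R}) (g : T -> \bar R).
Hypotheses (mg : measurable_fun [set: T] g) (g0 : forall x, 0 <= g x).

(** Made a measure below so that [finite_measure_eq_of_base] can compare it with [muh y]. *)
Definition with_density (A : set T) : \bar R := \int[nu]_(x in A) g x.

Let with_density0 : with_density set0 = 0.
Proof. exact: integral_set0. Qed.

Let with_density_ge0 A : 0 <= with_density A.
Proof. exact: integral_ge0. Qed.

Let with_density_sigma_additive : semi_sigma_additive with_density.
Proof. exact: semi_sigma_additive_nng_induced. Qed.

HB.instance Definition _ := isMeasure.Build _ _ _ with_density
  with_density0 with_density_ge0 with_density_sigma_additive.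

End with_density.

(** On each [F n] the function [u] is integrable, so equal integrals force equality almost
    everywhere there; the countably many exceptional sets have a null union. *)
Lemma ae_eq_of_integral d (T : measurableType d) (R : realType)
    (m : {measure set T -> \bar R}) (u v : T -> \bar R) (F : (set T)^nat) :
  measurable_fun [set: T] u -> measurable_fun [set: T] v ->
  (forall x, 0 <= u x) ->
  [set: T] = \bigcup_n F n -> (forall n, measurable (F n)) ->
  (forall n, \int[m]_(x in F n) u x < +oo) ->
  (forall A, measurable A -> \int[m]_(x in A) u x = \int[m]_(x in A) v x) ->
  \forall x \ae m, u x = v x.
Proof.
move=> mu mv u0 coverF mF Foo uv.
have H n : ae_eq m (F n) u v.
  apply: integral_ae_eq => //.
  - apply/integrableP; split; first exact: measurable_funTS.
    by under eq_integral do rewrite gee0_abs//.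
  - exact: measurable_funTS.
  - by move=> E _; exact: uv.
apply: filterS (ae_foralln H) => x Hx.
by have : [set: T] x by []; rewrite coverF => -[n _ /Hx].
Qed.

(** On a set of finite [mu]-measure [N] is [nu]-integrable, hence finite almost everywhere;
    countably many such sets cover the space. *)
Lemma sigma_finite_density_lty d (T : measurableType d) (R : realType)
    (mu nu : {measure set T -> \bar R}) (N : T -> \bar R) :
  measurable_fun [set: T] N -> (forall x, 0 <= N x) ->
  (forall A, measurable A -> mu A = \int[nu]_(x in A) N x) ->
  sigma_finite [set: T] mu -> \forall x \ae nu, N x < +oo.
Proof.
move=> mN N0 muE [F coverF mF].
have H n : \forall x \ae nu, F n x -> N x \is a fin_num.
  apply: integrable_ae; first exact: (mF n).1.
  apply/integrableP; split; first exact: measurable_funTS.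
  under eq_integral do rewrite gee0_abs//.
  by rewrite -muE; [exact: (mF n).2|exact: (mF n).1].
apply: filterS (ae_foralln H) => x Hx.
have : [set: T] x by [].
by rewrite coverF => -[n _ /Hx]; rewrite ge0_fin_numE.
Qed.

(** * Integrals against a measure carried by one fiber *)

Section fibers.
Context d d' (X : measurableType d) (Y : measurableType d') (R : realType).
Variables (h : X -> Y) (f : X -> \bar R).
Hypotheses (mh : measurable_fun [set: X] h)
  (m1Y : forall y : Y, measurable [set y]).
Hypotheses (mf : measurable_fun [set: X] f) (f0 : forall x, 0 <= f x).

Lemma measurable_preimage B : measurable B -> measurable (h @^-1` B).
Proof. by move=> mB; rewrite -[X in measurable X]setTI; exact: mh. Qed.

(** [m] is carried by the fiber over [y], which lies inside the preimage of [B] when [y] is in [B]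
    and is disjoint from it otherwise. *)
Lemma integral_fiber (m : {measure set X -> \bar R}) y A B :
  m (~` (h @^-1` [set y])) = 0 -> measurable A -> measurable B ->
  \int[m]_(x in A `&` h @^-1` B) f x =
    if y \in B then \int[m]_(x in A) f x else 0.
Proof.
move=> my0 mA mB; have mhB := measurable_preimage mB.
have mhy : measurable (~` (h @^-1` [set y])).
  exact/measurableC/measurable_preimage.
have mfD D : measurable_fun D f by exact: measurable_funTS.
rewrite (ge0_negligible_integral mhy _ _ _ my0)//; last exact: measurableI.
case: ifPn => [|] yB.
  rewrite [RHS](ge0_negligible_integral mhy _ _ _ my0)//.
  congr (integral m _ f); rewrite !setDE setCK -setIA; congr (_ `&` _).
  apply: setIidr => x /= ->; exact: set_mem yB.
rewrite [X in integral m X f](_ : _ = set0) ?integral_set0//.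
rewrite !setDE setCK -subset0 => x [[_ hxB] /= hxy].
by move: yB; rewrite notin_setE -hxy.
Qed.

End fibers.

(** * Countable bases along sigma-compact subsets of a metric space *)

Section metric_compact.
Context (R : realType) (X : ptopologicalType) (dist : X -> X -> R).
Hypotheses (dist0 : forall x y, (0 <= dist x y)%R /\ (dist x y = 0%R <-> x = y))
  (distC : forall x y, dist x y = dist y x)
  (distD : forall x y z, (dist x z <= dist x y + dist y z)%R)
  (nbhs_dist : forall (x : X) (A : set X), nbhs x A <->
     exists2 e : R, (0 < e)%R & [set y | (dist x y < e)%R] `<=` A).

Let dball x (e : R) : set X := [set y | (dist x y < e)%R].

Lemma open_dist_ball x e : open (dball x e).
Proof.
rewrite openE => y /= xye; apply/nbhs_dist; exists (e - dist x y)%R.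
  by rewrite subr_gt0.
by move=> z /= yz; apply: le_lt_trans (distD x y z) _; rewrite addrC -ltrBrDr.
Qed.

Lemma dist_ball_center x e : (0 < e)%R -> dball x e x.
Proof. by move=> e0; rewrite /dball /= (proj2 (proj2 (dist0 x x)) erefl). Qed.

Lemma metrizable_hausdorff : hausdorff_space X.
Proof.
move=> x y xy; apply/(proj2 (dist0 x y))/eqP.
rewrite eq_le (proj1 (dist0 x y)) andbT leNgt; apply/negP => xy0.
have e0 : (0 < dist x y / 2)%R by rewrite divr_gt0.
have nx : nbhs x (dball x (dist x y / 2)) by apply/nbhs_dist; exists (dist x y / 2)%R.
have ny : nbhs y (dball y (dist x y / 2)) by apply/nbhs_dist; exists (dist x y / 2)%R.
have [z [/= xz yz]] := xy _ _ nx ny.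
have := distD x z y; rewrite (distC z y) leNgt => /negP; apply.
by rewrite [ltRHS]splitr ltrD.
Qed.

(* The members of [g] are the balls of radius 1/(n+1) around the finitely many
   centers given by compactness of [K m]. *)
Lemma sigma_compact_base (K : nat -> set X) : (forall m, compact (K m)) ->
  exists g : nat -> set X, (forall i, open (g i)) /\
    forall U x, open U -> U x -> (\bigcup_m K m) x ->
      exists2 i, g i x & g i `<=` U.
Proof.
move=> cK; pose r n : R := (n.+1%:R^-1)%R.
have r0 n : (0 < r n)%R by rewrite /r invr_gt0 ltr0n.
have /choice[D HD] (p : nat * nat) : exists D : seq X,
    K p.1 `<=` [set x | exists2 c, c \in D & dball c (r p.2) x].
  have := cK p.1; rewrite compact_cover => /(_ X (K p.1) (dball^~ (r p.2))).
  case=> [c _|x Kx|D _ KD].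
  - exact: open_dist_ball.
  - by exists x => //; exact: dist_ball_center.
  - by exists (finmap.enum_fset D) => x /KD[c /= cD cx]; exists c.
pose g i := if @unpickle (nat * nat * nat)%type i is Some (p, j)
  then dball (nth point (D p) j) (r p.2) else set0.
exists g; split=> [i|U x oU Ux [m _ Kx]].
  rewrite /g; case: unpickle => [[p j]|]; [exact: open_dist_ball|exact: open0].
have /nbhs_dist[e e0 eU] : nbhs x U by exact: open_nbhs_nbhs.
(* Half of [e] suffices: a ball of radius [r n] containing [x] has all its points within
   [2 * r n < e] of [x]. *)
have [n ne] : exists n, (r n < e / 2)%R.
  have e20 : (0 < e / 2)%R by rewrite divr_gt0.
  exists (Num.truncn (e / 2)^-1)%R; rewrite /r invf_plt ?posrE//.
  exact: truncnS_gt.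
have [c cD cx] := HD (m, n) x Kx.
exists (pickle (m, n, index c (D (m, n)))); rewrite /g pickleK nth_index//.
move=> z cz; apply: eU => /=; apply: le_lt_trans (distD x c z) _.
by rewrite [ltRHS]splitr ltrD// (lt_trans _ ne)// distC.
Qed.

End metric_compact.

(** * Radon measures: sigma-compact carriers and uniqueness from a countable base *)

Section separable_support.
Context (R : realType) (X : ptopologicalType).
Implicit Types m : {measure set (borel X) -> \bar R}.

Lemma measurable_open (U : set (borel X)) : open (U : set X) -> measurable U.
Proof. exact: sub_sigma_algebra. Qed.

Lemma measurable_compact (metrX : metrizable R X) (K : set (borel X)) :
  compact (K : set X) -> measurable K.
Proof.
move=> cK; have [dist [d0 dC dD dn]] := metrX.
have /closed_openC oK : closed (K : set X).
  exact: compact_closed (metrizable_hausdorff d0 dC dD dn) cK.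
rewrite -(setCK K); apply: measurableC; exact: measurable_open.
Qed.

(** Finite unions of the [g i] need not be stable under intersection, so uniqueness is applied to
    the pi-system of all open sets. Up to a null set outside [S], an open set is the increasing
    union of finite unions of the [g i] it contains. *)
Lemma finite_measure_eq_of_base (S : set (borel X)) (g : nat -> set (borel X))
    (m1 m2 : {measure set (borel X) -> \bar R}) :
  measurable S -> (forall i, open (g i : set X)) ->
  (forall (U : set X) x, open U -> U x -> S x ->
    exists2 i, g i x & g i `<=` U) ->
  m1 (~` S) = 0 -> m2 (~` S) = 0 -> m1 [set: X] < +oo ->
  (forall s : seq nat, m1 (\big[setU/set0]_(i <- s) g i) =
                       m2 (\big[setU/set0]_(i <- s) g i)) ->
  m1 [set: X] = m2 [set: X] ->
  forall A, measurable A -> m1 A = m2 A.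
Proof.
move=> mS og gbase m1S m2S m1oo m12 m12T.
have mg i : measurable (g i) by exact: measurable_open.
suff m12U (U : set (borel X)) : open (U : set X) -> m1 U = m2 U.
  move=> A mA.
  refine (@measure_unique _ R (borel X) (@open X : set (set (borel X))) (fun=> [set: borel X]) _ _ _ _ m1 m2 _ _ A mA) => //.
  - exact: openI.
  - by move=> _; exact: openT.
  - by rewrite bigcup_const.
move=> oU; pose P i := `[< g i `<=` U >].
pose H i : set (borel X) := if P i then g i else set0.
pose G n : set (borel X) := \big[setU/set0]_(i < n) H i.
have mG n : measurable (G n).
  by apply: bigsetU_measurable => i _; rewrite /H; case: ifP.
have ndG : nondecreasing_seq G.
  by move=> a b ab; apply/subsetPset; exact: subset_bigsetU.
have mUG : measurable (\bigcup_n G n) by exact: bigcup_measurable.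
have GU : \bigcup_n G n `<=` U.
  move=> x [n _]; rewrite /G -bigcup_mkord => -[i _].
  by rewrite /H; case: ifPn => // /asboolP; exact.
have mUE m : m (~` S) = 0 -> m U = m (\bigcup_n G n).
  move=> mS0; apply/eqP; rewrite eq_le; apply/andP; split; last first.
    by apply: le_measure; rewrite ?inE//; exact: measurable_open.
  (* The sets [G n] need only exhaust [U] inside [S]; adding the null complement of [S] covers the
     rest. *)
  have -> : m (\bigcup_n G n) = m (\bigcup_n G n `|` ~` S).
    rewrite measureU0//; exact: measurableC.
  apply: le_measure; rewrite ?inE.
  - exact: measurable_open.
  - by apply: measurableU => //; exact: measurableC.
  move=> x Ux; have [Sx|] := pselect (S x); last by right.
  left; have [i gix giU] := gbase U x oU Ux Sx.
  (* [G n] uses indices below [n], so [g i] first enters at [i.+1]. *)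
  by exists i.+1 => //; rewrite /G big_ord_recr /=; right; rewrite /H /P asboolT.
have mlim m : m (\bigcup_n G n) = limn (m \o G).
  by apply/esym/cvg_lim => //; exact: nondecreasing_cvg_mu.
rewrite (mUE m1)// (mUE m2)// !mlim; congr (limn _); apply/funext => n /=.
have -> : G n = \big[setU/set0]_(i <- [seq i <- index_iota 0 n | P i]) g i.
  by rewrite big_filter big_mkcond big_mkord.
exact: m12.
Qed.

(** Inner regularity gives compact subsets of [A] missing measure less than 1/(n+1); since [m A] is
    finite, measures can be subtracted, and the part of [A] outside the union is below every such
    bound. *)
Lemma radon_inner_compact m (A : set (borel X)) (metrX : metrizable R X) :
  radon m -> measurable A -> m A < +oo ->
  exists K : nat -> set X,
    (forall n, compact (K n)) /\ m (A `\` \bigcup_n K n) = 0.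
Proof.
move=> [_ inner] mA Aoo.
have finA : m A \is a fin_num by rewrite ge0_fin_numE.
have /choice[K HK] (n : nat) : exists K : set (borel X),
    [/\ compact (K : set X), K `<=` A & m A - (n.+1%:R^-1)%R%:E < m K].
  have := @ub_ereal_sup_adherent R
    [set m K | K in [set K : set X | compact K /\ K `<=` A]] (n.+1%:R^-1)%R.
  rewrite -inner// invr_gt0 ltr0n => /(_ isT finA)[_ [K [cK KA] <-] HK].
  by exists K.
have mK n : measurable (K n) by apply: measurable_compact => //; case: (HK n).
have mUK : measurable (\bigcup_n K n) by exact: bigcup_measurable.
exists K; split=> [n|]; first by case: (HK n).
have le n : m (A `\` \bigcup_n K n) <= (n.+1%:R^-1)%R%:E.
  have [_ KA lt] := HK n.
  apply: (@le_trans _ _ (m (A `\` K n))).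
    apply: le_measure; rewrite ?inE; [exact: measurableD..|].
    by apply: setDS => x Kx; exists n.
  rewrite measureD//.
  rewrite setIidr// leeBlDr//; last first.
    by rewrite ge0_fin_numE// (le_lt_trans _ Aoo)// le_measure// inE.
  rewrite addeC -leeBlDr//; exact: ltW.
apply/eqP; rewrite eq_le measure_ge0 andbT; apply/lee_addgt0Pr => e e0.
rewrite add0e (le_trans (le (Num.truncn e^-1%R)))// lee_fin.
by rewrite invf_ple ?posrE//; exact/ltW/truncnS_gt.
Qed.

Lemma radon_sigma_compact m (metrX : metrizable R X) :
  sigma_finite [set: borel X] m -> radon m ->
  exists K : nat -> set (borel X), (forall n, compact (K n : set X)) /\
    m (~` \bigcup_n K n) = 0.
Proof.
move=> [F coverF mF] rm.
have /choice[K HK] n := radon_inner_compact metrX rm (mF n).1 (mF n).2.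
(* The double family is listed as one sequence; codes of no pair yield the empty set, which is
   compact. *)
pose L i := if @unpickle (nat * nat)%type i is Some (n, j) then K n j else set0.
have cL i : compact (L i).
  rewrite /L; case: unpickle => [[n j]|]; last exact: compact0.
  exact: (HK n).1.
exists L; split=> //.
have mL i : measurable (L i : set (borel X)) by exact: measurable_compact.
have mUL : measurable (\bigcup_i L i : set (borel X)).
  exact: bigcup_measurable.
apply/(@negligibleP _ _ _ m); first exact: measurableC.
have Fneg n : m.-negligible (F n `\` \bigcup_i L i : set (borel X)).
  have mUK : measurable (\bigcup_j K n j : set (borel X)).
    apply: bigcup_measurable => j _; apply: measurable_compact => //.
    exact: (HK n).1.
  apply: (@negligibleS _ _ _ _ (F n `\` \bigcup_j K n j)).
    apply: setDS => x [j _ Kx]; exists (pickle (n, j)) => //.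
    by rewrite /L pickleK.
  apply/negligibleP; last exact: (HK n).2.
  by apply: measurableD => //; exact: (mF n).1.
apply: negligibleS (negligible_bigcup Fneg) => x Lx.
by have : [set: borel X] x by []; rewrite coverF => -[n _ Fx]; exists n.
Qed.

End separable_support.

(** The measure structure on a pushforward depends on a proof that [h] is measurable; naming the
    resulting measure hides that dependence behind [lam] and [rho]. *)
Lemma pushforward_is_measure d d' (X : measurableType d) (Y : measurableType d')
    (R : realType) (h : X -> Y) (mu : {measure set X -> \bar R}) :
  measurable_fun [set: X] h ->
  exists m : {measure set Y -> \bar R}, pushforward mu h = m.
Proof. by move=> mh; eexists; reflexivity. Unshelve. exact: mh. Qed.

(** * Comparison of the two disintegrations, one measurable set at a time *)

Section disintegrated_density.
Context d d' (X : measurableType d) (Y : measurableType d') (R : realType).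
Variables (h : X -> Y) (mu nu : {measure set X -> \bar R}).
Variables (lam rho : {measure set Y -> \bar R}).
Variables (muh nuh : R.-ker Y ~> X) (f : X -> \bar R).
Hypotheses (mh : measurable_fun [set: X] h)
  (m1Y : forall y : Y, measurable [set y]).
Hypotheses (lamE : pushforward mu h = lam) (rhoE : pushforward nu h = rho).
Hypothesis sf_lam : sigma_finite [set: Y] lam.
Hypotheses (dis_mu : disintegration mu h muh) (dis_nu : disintegration nu h nuh).
Hypothesis dens_f : is_density mu nu f.

Let mf : measurable_fun [set: X] f. Proof. by case: dens_f. Qed.
Let f0 x : 0 <= f x. Proof. by case: dens_f. Qed.
Let mhB B : measurable B -> measurable (h @^-1` B).
Proof. exact: measurable_preimage. Qed.

Let N y := \int[nuh y]_x f x.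

Let N0 y : 0 <= N y. Proof. exact: integral_ge0. Qed.

Lemma measurable_kernel_integral A : measurable A ->
  measurable_fun [set: Y] (fun y => \int[nuh y]_(x in A) f x).
Proof.
move=> mA; under eq_fun do rewrite integral_mkcond.
apply: measurable_fun_integral_kernel.
- by move=> U; exact: measurable_kernel.
- by move=> x; rewrite erestrict_ge0.
- by apply/(measurable_restrictT _ mA); exact: measurable_funTS.
Qed.

Let mN : measurable_fun [set: Y] N.
Proof. exact: measurable_kernel_integral. Qed.

Lemma integral_disintegration A B : measurable A -> measurable B ->
  mu (A `&` h @^-1` B) = \int[lam]_(y in B) muh y A.
Proof.
move=> mA mB; have mAB : measurable (A `&` h @^-1` B).
  by apply: measurableI => //; exact: mhB.
have [fib ->//] := dis_mu; rewrite lamE [RHS]integral_mkcond.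
apply: eq_integral => y _.
(* For the constant integrand 1, [integral_fiber] speaks of the [muh y]-measure of sets. *)
have := @integral_fiber _ _ _ _ _ h (cst 1) mh m1Y (measurable_cst _)
  (fun=> lee01) (muh y) y A B (fib y) mA mB.
by rewrite !integral_cst// !mul1e patchE.
Qed.

(** Density first, disintegration second: [mu] is an integral of [f] against [nu], and [nu] is the
    mixture of the [nuh y] over [rho]. *)
Lemma integral_disintegration_density A B : measurable A -> measurable B ->
  mu (A `&` h @^-1` B) = \int[rho]_(y in B) \int[nuh y]_(x in A) f x.
Proof.
move=> mA mB; have mAB : measurable (A `&` h @^-1` B).
  by apply: measurableI => //; exact: mhB.
have [fib nuE] := dis_nu; have [_ _ ->//] := dens_f.
rewrite integral_mkcond (@integral_mixture _ _ _ _ _ rho nuh).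
- rewrite [RHS]integral_mkcond; apply: eq_integral => y _.
  by rewrite -integral_mkcond (integral_fiber mh _ _ _ (fib y))// patchE.
- by move=> U; exact: measurable_kernel.
- by rewrite -rhoE.
- by apply/(measurable_restrictT _ mAB); exact: measurable_funTS.
- by move=> x; rewrite erestrict_ge0.
Qed.

Lemma pushforward_density B : measurable B -> lam B = \int[rho]_(y in B) N y.
Proof.
move=> mB; rewrite -lamE /pushforward -[h @^-1` B]setTI.
exact: integral_disintegration_density.
Qed.

(** Since [lam] has density [N] with respect to [rho], every [rho]-null set is [lam]-null. *)
Lemma ae_pushforward_density (P : Y -> Prop) :
  (\forall y \ae rho, P y) -> \forall y \ae lam, P y.
Proof.
move=> [A [mA A0 sub]]; exists A; split => //.
rewrite pushforward_density//.
rewrite (@ge0_negligible_integral _ _ _ _ _ A)//; last exact: measurable_funTS.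
by rewrite setDv integral_set0.
Qed.

Lemma ae_normalization_lty : \forall y \ae rho, N y < +oo.
Proof. exact: (sigma_finite_density_lty mN N0 pushforward_density). Qed.

(** The zero set of [N] has [lam]-measure equal to the integral of [N] over it. Its [rho]-measure
    may be positive, so the claim concerns [lam] only. *)
Lemma ae_normalization_gt0 : \forall y \ae lam, 0 < N y.
Proof.
have mZ : measurable (N @^-1` [set 0]).
  by rewrite -[X in measurable X]setTI; exact: mN.
exists (N @^-1` [set 0]); split => //.
  rewrite pushforward_density//; apply: integral0_eq => y; exact.
move=> y /= /negP; rewrite -leNgt => Ny0.
by apply/eqP; rewrite eq_le Ny0 N0.
Qed.

(** Over any [B], both sides have [rho]-integral [mu] of the part of [A] above [B]. These integrals
    are finite on the pieces given by sigma-finiteness of [lam], so [ae_eq_of_integral] applies. *)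
Lemma ae_kernel_density A : measurable A ->
  \forall y \ae rho, \int[nuh y]_(x in A) f x = N y * muh y A.
Proof.
move=> mA; have mg := measurable_kernel_integral mA.
(* A real-valued version of [N], as [integral_density] requires; [fine] changes [N] only where it is
   infinite, a [rho]-null set. *)
pose N' y := fine (N y).
have mN' : measurable_fun [set: Y] N'.
  exact: measurableT_comp (fine_measurable measurableT) mN.
have N'0 y : (0 <= N' y)%R by exact: fine_ge0.
have aeN : \forall y \ae rho, N y = (N' y)%:E.
  by apply: filterS ae_normalization_lty => y Ny; rewrite fineK// ge0_fin_numE.
have mmuA : measurable_fun [set: Y] (muh ^~ A) by exact: measurable_kernel.
suff : \forall y \ae rho, \int[nuh y]_(x in A) f x = (N' y)%:E * muh y A.
  by apply: filterS2 aeN => y -> ->.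
have [F coverF mF] := sf_lam.
apply: (@ae_eq_of_integral _ _ _ _ _ _ F) => //.
- by apply: emeasurable_funM => //; exact/measurable_EFinP.
- by move=> y; exact: integral_ge0.
- by move=> n; exact: (mF n).1.
- move=> n; have [mFn Fnoo] := mF n.
  rewrite -integral_disintegration_density//.
  apply: le_lt_trans Fnoo; rewrite -lamE /pushforward.
  apply: le_measure; rewrite ?inE//; [|exact: mhB].
  by apply: measurableI => //; exact: mhB.
- move=> B mB; rewrite -integral_disintegration_density//.
  rewrite integral_disintegration// integral_mkcond.
  rewrite (integral_density mN' N'0 (nu := rho)).
  + rewrite [RHS]integral_mkcond; apply: eq_integral => y _.
    by rewrite !patchE; case: ifPn => _ //; rewrite mule0.
  + move=> D mD; rewrite pushforward_density//.
    apply: ge0_ae_eq_integral => //.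
    * exact: measurable_funTS.
    * by apply: measurable_funTS; exact/measurable_EFinP.
    * by move=> y _; rewrite lee_fin.
    * by apply: filterS aeN => y ->.
  + by apply/(measurable_restrictT _ mB); exact: measurable_funTS.
  + by move=> y; rewrite erestrict_ge0.
Qed.

Lemma ae_kernel_null A : measurable A -> mu A = 0 ->
  \forall y \ae lam, muh y A = 0.
Proof.
move=> mA; have [_ ->//] := dis_mu; rewrite lamE => int0.
have : ae_eq lam [set: Y] (muh ^~ A) (cst 0).
  apply/ae_eq_integral_abs => //; first exact: measurable_kernel.
  by under eq_integral do rewrite gee0_abs//.
by apply: filterS => y; exact.
Qed.

End disintegrated_density.

(** * From single sets to all Borel sets, for almost every fiber *)

Theorem lemma2p9 (R : realType) (X : ptopologicalType) (d : measure_display)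
  (Y : measurableType d) (h : borel X -> Y)
  (mu nu : {measure set (borel X) -> \bar R})
  (muh nuh : R.-ker Y ~> borel X) (f : borel X -> \bar R)
  (metrX : metrizable R X)
  (cgY : countably_generated Y)
  (m1Y : forall y : Y, measurable [set y])
  (mh : measurable_fun [set: borel X] h)
  (sf_mu : sigma_finite [set: borel X] mu)
  (sf_nu : sigma_finite [set: borel X] nu)
  (radon_mu : radon mu) (radon_nu : radon nu)
  (sf_hmu : sigma_finite [set: Y] (pushforward mu h))
  (sf_hnu : sigma_finite [set: Y] (pushforward nu h))
  (mu_nu : mu `<< nu)
  (dis_mu : disintegration mu h muh)
  (dis_nu : disintegration nu h nuh)
  (dens_f : is_density mu nu f) :
  (\forall y \ae pushforward mu h,
     muh y `<< nuh y /\
     is_density (muh y) (nuh y) (fun x => f x / \int[nuh y]_z f z)) /\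
  (\forall y \ae pushforward mu h, 0 < \int[nuh y]_z f z).
Proof.
have [lam lamE] := pushforward_is_measure mu mh.
have [rho rhoE] := pushforward_is_measure nu mh.
have [mf f0 _] := dens_f.
move: sf_hmu; rewrite lamE => sf_lam.
have Ngt0 := ae_normalization_gt0 mh m1Y lamE rhoE dis_nu dens_f.
split => //.
have rho_lam P := @ae_pushforward_density _ _ _ _ _ h mu nu lam rho nuh f mh m1Y
  lamE rhoE dis_nu dens_f P.
have Nlty := rho_lam _
  (ae_normalization_lty mh m1Y lamE rhoE sf_lam dis_nu dens_f).
have kerE A mA := rho_lam _
  (@ae_kernel_density _ _ _ _ _ h mu nu lam rho muh nuh f mh m1Y
    lamE rhoE sf_lam dis_mu dis_nu dens_f A mA).
have [K [cK muK]] := radon_sigma_compact metrX sf_mu radon_mu.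
have [g [og gbase]] : exists g : nat -> set X, (forall i, open (g i)) /\
    forall U x, open U -> U x -> (\bigcup_m K m) x ->
      exists2 i, g i x & g i `<=` U.
  have [dist [d0 dC dD dn]] := metrX.
  exact: (sigma_compact_base d0 dC dD dn cK).
pose S : set (borel X) := \bigcup_m K m.
have mS : measurable S.
  by apply: bigcup_measurable => n _; exact: (measurable_compact metrX).
have mCS : measurable (~` S) by exact: measurableC.
pose C (s : seq nat) : set (borel X) := \big[setU/set0]_(i <- s) g i.
have mC s : measurable (C s).
  by apply: bigsetU_measurable => i _; exact: measurable_open.
have aeC : \forall y \ae lam, forall s,
    \int[nuh y]_(x in C s) f x = (\int[nuh y]_x f x) * muh y (C s).
  (* There are countably many lists [s]; indexing them by their codes lets the quantifier over [s]
     move inside the almost-everywhere statement. *)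
  pose P n y := forall s, unpickle n = Some s ->
    \int[nuh y]_(x in C s) f x = (\int[nuh y]_x f x) * muh y (C s).
  have : forall n, \forall y \ae lam, P n y.
    move=> n; rewrite /P; case: (unpickle n) => [s|]; last by apply: aeW.
    by apply: filterS (kerE _ (mC s)) => y ys _ [<-].
  move=> /ae_foralln; apply: filterS => y Py s.
  by apply: (Py (pickle s)); rewrite pickleK.
have muS := ae_kernel_null lamE dis_mu mCS muK.
have nuS := kerE _ mCS.
have nuT := kerE _ measurableT.
near=> y.
have N0 : 0 < \int[nuh y]_x f x by near: y.
have Noo : \int[nuh y]_x f x < +oo by near: y.
have muSy : muh y (~` S) = 0 by near: y.
have Cy s : \int[nuh y]_(x in C s) f x = (\int[nuh y]_x f x) * muh y (C s).
  by move: s; near: y.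
have nuSy : \int[nuh y]_(x in ~` S) f x = (\int[nuh y]_x f x) * muh y (~` S).
  by near: y.
have Ty : \int[nuh y]_x f x = (\int[nuh y]_x f x) * muh y [set: borel X].
  by near: y.
set N := (\int[nuh y]_x f x)%E in N0 Noo Cy nuSy Ty *.
(* Once [N] is a positive real, division by it is multiplication by the real [r^-1], also at points
   where [f] is infinite. *)
have [r r0 NE] : exists2 r : R, (0 < r)%R & N = r%:E.
  exists (fine N); first by rewrite fine_gt0// N0.
  by rewrite fineK// ge0_fin_numE// ltW.
have divNE x : x / N = x * (r^-1)%R%:E by rewrite NE inver gt_eqF.
have q0 x : 0 <= f x / N by rewrite divNE mule_ge0// lee_fin invr_ge0 ltW.
have mq : measurable_fun [set: borel X] (fun x => f x / N).
  under eq_fun do rewrite divNE muleC; exact: measurable_funeM.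
(* Divides the fiber identity for one set by [N]. It is applied to the complement of [S], to the
   finite unions [C s] and to the whole space. *)
have denE A : measurable A ->
    \int[nuh y]_(x in A) f x = N * muh y A ->
    muh y A = with_density (nuh y) (fun x => f x / N) A.
  move=> mA gE; rewrite /with_density.
  under eq_integral do rewrite divNE.
  rewrite ge0_integralZr//; [|exact: measurable_funTS|].
    rewrite gE NE muleC muleA -EFinM mulVf ?mul1e// gt_eqF//.
  by rewrite lee_fin invr_ge0 ltW.
have muhE A : measurable A -> muh y A = \int[nuh y]_(x in A) (f x / N).
  apply: (@finite_measure_eq_of_base R X S g (muh y)
    (with_density (nuh y) (fun x => f x / N))) => //.
  - by transitivity (muh y (~` S)) => //; apply/esym; exact: denE mCS nuSy.
  (* [Ty] says that [N] equals [N] times the total mass of [muh y]; an infinite mass would make the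
     positive real [N] infinite. *)
  - rewrite ltey; apply/eqP => Too; move: Ty.
    by rewrite Too -/N NE gt0_muley ?lte_fin.
  - by move=> s; exact: denE (mC s) (Cy s).
  - exact: denE measurableT Ty.
split=> //.
apply/null_content_dominatesP => A mA A0; rewrite muhE//.
rewrite (@ge0_negligible_integral _ _ _ _ _ A)//; last exact: measurable_funTS.
by rewrite setDv integral_set0.
Unshelve. all: by end_near. Qed.
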